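(* Let $u>0$, $t\ge0$ with $\xi t/u-t+1>0$. If the game $(a(x),F(x))$ is effective, then $$\lim_{\substack{n\to+\infty\\N\to+\infty}}V[X_{N,n}]=0,$$ where $V$ denotes variance.
   Context: Setting: $I\subseteq\mathbb R$ is an interval, $F$ is a probability distribution function on $I$, and $\int_I g(x)\,d(F(x))$ is the Lebesgue–Stieltjes integral with respect to the associated probability measure. $a:I\to\mathbb R$ is measurable, $\xi:=\inf_{x\in I}a(x)>-\infty$, and $\xi$ is the essential infimum of $a$: $\int_{a(x)<\xi+\varepsilon}d(F(x))>0$ for all $\varepsilon>0$. $a$ is not a.e. constant. $\int_I a(x)\,d(F(x))\in(0,+\infty]$. The game $(a(x),F(x))$ is called effective if $\int_{a(x)>1}a(x)^\nu d(F(x))<+\infty$ for some $\nu>0$ (in addition to the standing conditions $\int_I a\,dF>0$ and $\xi>-\infty$). $(f_N)_{N\ge1}$ is a sequence of step functions on $I$ with $\xi\le f_N(x)\le f_{N+1}(x)\le a(x)$ and $\lim_{N\to\infty}f_N(x)=a(x)$ for all $x\in I$. Each $f_N$ has finitely many levels $\xi=a_1<a_2<\dots<a_M$ ($M$ and the $a_j$ depending on $N$), with $f_N(x)=a_j$ when $a_j\le a(x)<a_{j+1}$ ($1\le j\le M-1$) and $f_N(x)=a_M$ when $a(x)\ge a_M$. (Example: $M=2^NN+1$, $a_j=\xi+(j-1)/2^N$.) Put $p_j:=\int_{a_j\le a(x)<a_{j+1}}d(F(x))$ for $j\le M-1$ and $p_M:=\int_{a(x)\ge a_M}d(F(x))$.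 For $u>0$, $t\ge0$ with $\xi t/u-t+1>0$, $X_{N,n}$ is the growth rate per attempt after $n$ attempts in the game $\{(a_j,p_j)\}$: $X_{N,n}=\left(\prod_{i=1}^n(Y_it/u-t+1)\right)^{1/n}$ with $Y_1,\dots,Y_n$ i.i.d., $P(Y_i=a_j)=p_j$. Thus $V[X_{N,n}]=\left(\sum_{j=1}^M(a_jt/u-t+1)^{2/n}p_j\right)^n-\left(\sum_{j=1}^M(a_jt/u-t+1)^{1/n}p_j\right)^{2n}$. The double limit means $n$ and $N$ tend to infinity jointly. *)

(* Defs.v *)
From HB Require Import structures.
From mathcomp Require Import all_boot all_order all_algebra.
From mathcomp Require Import all_classical all_reals all_analysis.

Set Implicit Arguments.
Unset Strict Implicit.
Unset Printing Implicit Defensive.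

Import Order.TTheory GRing.Theory Num.Theory.
Import numFieldNormedType.Exports.

Local Open Scope classical_set_scope.
Local Open Scope ring_scope.

(* In this file a game is a payoff a, considered on a set I, together with the
   measure mu that gives the chances (for a distribution function F, the
   Lebesgue-Stieltjes measure of F). *)

Definition payoff_inf (T : Type) (R : realType)
    (I : set T) (a : T -> R) : R := inf (a @` I).

Definition is_game d (T : measurableType d) (R : realType)
    (mu : {measure set T -> \bar R}) (I : set T) (a : T -> R) : Prop :=
  [/\ measurable_fun I a,
      has_lbound (a @` I),
      forall e : R, 0 < e ->
        (0 < mu (I `&` [set x | (a x < payoff_inf I a + e)%R]))%E,
      ~ (exists c : R, {ae mu, forall x, I x -> a x = c}) &
      (0 < \int[mu]_(x in I) (a x)%:E)%E].

Definition effective d (T : measurableType d) (R : realType)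
    (mu : {measure set T -> \bar R}) (I : set T) (a : T -> R) : Prop :=
  is_game mu I a /\
  exists2 nu : R, 0 < nu &
    (\int[mu]_(x in I `&` [set x | (1 < a x)%R]) (a x `^ nu)%:E < +oo)%E.

(* Levels are numbered from 0: s`_j is a_(j+1), and the last cell, for which
   j.+1 = size s, has no upper bound. *)
Definition cell (T : Type) (R : realType)
    (I : set T) (a : T -> R) (s : seq R) (j : nat) : set T :=
  [set x | [/\ I x, s`_j <= a x & (j.+1 < size s)%N -> a x < s`_j.+1]].

Definition is_step_approximation (T : Type) (R : realType)
    (I : set T) (a : T -> R) (f : nat -> T -> R) (lev : nat -> seq R) : Prop :=
  [/\ forall N, [/\ (0 < size (lev N))%N, (lev N)`_0 = payoff_inf I a &
                    sorted <%R (lev N)],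
      forall N j x, (j < size (lev N))%N -> cell I a (lev N) j x ->
        f N x = (lev N)`_j,
      forall N x, I x ->
        [/\ payoff_inf I a <= f N x, f N x <= f N.+1 x & f N.+1 x <= a x] &
      forall x, I x -> f N x @[N --> \oo] --> a x].

Definition mutually_independent d (Omega : measurableType d) (R : realType)
    (P : probability Omega R) (n : nat) (Y : 'I_n -> {RV P >-> R}) : Prop :=
  forall (J : {set 'I_n}) (B : 'I_n -> set R), (forall i, measurable (B i)) ->
    P (\bigcap_(i in [set` J]) (Y i @^-1` B i)) =
    (\prod_(i in J) P (Y i @^-1` B i))%E.

(* Y lists the results of n attempts in the game {(a_j, p_j)}, where
   p_j = mu (cell I a s j).  When mu I = 1 and s`_0 is a lower bound of a on I,
   the p_j add up to 1, so they determine the common law of the Y i. *)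
Definition are_attempts d (T : measurableType d) (R : realType)
    (mu : {measure set T -> \bar R}) (I : set T) (a : T -> R) (s : seq R)
    d' (Omega : measurableType d') (P : probability Omega R) (n : nat)
    (Y : 'I_n -> {RV P >-> R}) : Prop :=
  mutually_independent Y /\
  forall (i : 'I_n) (j : nat), (j < size s)%N ->
    P (Y i @^-1` [set s`_j]) = mu (cell I a s j).

(* In the intended use every factor is almost surely positive, because almost
   surely Y i >= xi and xi * t / u - t + 1 > 0; the value of `^ at a negative
   base therefore plays no role. *)
Definition growth_rate (R : realType) (Omega : Type) (u t : R) (n : nat)
    (Y : 'I_n -> Omega -> R) (w : Omega) : R :=
  (\prod_(i < n) (Y i w * t / u - t + 1)) `^ (n%:R^-1).

(* Main.v *)
(* The variance tends to 0 as n -> oo uniformly in N.  Let y_j = a_j t/u - t + 1,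
   l_j = ln y_j and m = sum_j p_j l_j.  By independence
   V = (sum_j p_j y_j^(2/n))^n - (sum_j p_j y_j^(1/n))^(2n).
   Jensen's inequality bounds the subtracted term below by e^(2m), and
   e^z <= 1 + z + z^2 e^|z| bounds the first term above by e^(2m + 4K/n), where K
   bounds sum_j p_j l_j^2 e^(nu |l_j| / 2).  Since a_j <= a on the j-th cell and
   the y_j are bounded away from 0, effectiveness gives m and K bounds that do
   not depend on N, so V <= C (e^(4K/n) - 1). *)
Require Import Defs.
From HB Require Import structures.
From mathcomp Require Import all_boot all_order all_algebra.
From mathcomp Require Import all_classical all_reals all_analysis.
From mathcomp Require Import measurable_realfun ring lra.

Set Implicit Arguments.
Unset Strict Implicit.
Unset Printing Implicit Defensive.

Import Order.TTheory GRing.Theory Num.Theory.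
Import numFieldNormedType.Exports.

Local Open Scope classical_set_scope.
Local Open Scope ring_scope.

(** * Elementary inequalities for the exponential *)

Lemma expR_le_quadratic (R : realType) (z : R) :
  expR z <= 1 + z + z ^+ 2 * expR `|z|.
Proof.
(* This is 1 - z <= e^(-z) multiplied by e^z. It settles z >= 0 directly; for z < 0 it is combined
   with e^z >= 1 + z, whose product with z reverses. *)
have h1 : expR z - 1 <= z * expR z.
  have := expR_ge1Dx (- z); have := expR_gt0 z; have := expRxMexpNx_1 z.
  by nra.
have [z0|z0] := leP 0 z.
  by rewrite ger0_norm//; have := expR_gt0 z; nra.
have := expR_ge1Dx z; have : 1 <= expR `|z| by rewrite leNgt expR_lt1 -leNgt.
nra.
Qed.

(** The quadratic Taylor term (k|x|)^2 / 2 is below e^(k|x|). It trades a squared logarithm for an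
    arbitrarily small exponent. *)
Lemma sqr_le_expR_norm (R : realType) (k x : R) : 0 < k ->
  x ^+ 2 <= 2 / k ^+ 2 * expR (k * `|x|).
Proof.
move=> k0; have kx : 0 <= k * `|x| by rewrite mulr_ge0// ltW.
rewrite mulrAC ler_pdivlMr ?exprn_gt0// -(real_normK (num_real x)) mulrC -exprMn.
have := expR_ge1Dxn 1 kx; rewrite (_ : (2`!)%:R = 2 :> R)//; lra.
Qed.

(** * Finite weighted means of exponentials *)

Section Weighted.
Variables (R : realType) (J : finType) (p l : J -> R).
Hypothesis p0 : forall j, 0 <= p j.
Hypothesis p1 : \sum_j p j = 1.
Let m : R := \sum_j p j * l j.

(** Jensen's inequality by the tangent line of exp at [s * m], s = 1/n: in the mean over [p] its
    linear term cancels. *)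
Lemma expR_mean_le (n : nat) : (0 < n)%N ->
  expR m <= (\sum_j p j * expR (n%:R^-1 * l j)) ^+ n.
Proof.
move=> n0.
have n0' : n%:R != 0 :> R by rewrite pnatr_eq0 -lt0n.
rewrite (_ : m = n%:R * (n%:R^-1 * m)); last by rewrite mulrA mulfV ?mul1r.
rewrite expRM_natl lerXn2r// ?nnegrE ?expR_ge0//.
  by apply: sumr_ge0 => j _; rewrite mulr_ge0 ?expR_ge0.
set s := n%:R^-1.
have : \sum_j p j * (expR (s * m) * (1 + (s * l j - s * m))) <=
    \sum_j p j * expR (s * l j).
  apply: ler_sum => j _; apply: ler_wpM2l => //.
  by rewrite -[in leRHS](subrK (s * m) (s * l j)) expRD mulrC
    ler_wpM2r ?expR_ge0// expR_ge1Dx.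
have E x : \sum_j p j * (expR x * (1 + (s * l j - x))) =
    expR x * (1 - x) * (\sum_j p j) + expR x * s * (\sum_j p j * l j).
  by rewrite !mulr_sumr -big_split/=; apply: eq_bigr => j _; ring.
by rewrite E p1 -/m => /(le_trans _); apply; rewrite le_eqVlt; apply/orP; left;
  apply/eqP; ring.
Qed.

(** The mean of e^z <= 1 + z + z^2 e^|z| at z = s l_j is at most 1 + s m + s^2 Q, hence at most e^(s
    m + s^2 Q). For s = 2/n the n-th power leaves 2m plus an error 4Q/n. *)
Lemma sum_expR_pow_le (n : nat) (s Q : R) : 0 <= s ->
  \sum_j p j * (l j ^+ 2 * expR (s * `|l j|)) <= Q ->
  (\sum_j p j * expR (s * l j)) ^+ n <= expR (n%:R * (s * m + s ^+ 2 * Q)).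
Proof.
move=> s0 hQ.
rewrite expRM_natl lerXn2r// ?nnegrE ?expR_ge0//.
  by apply: sumr_ge0 => j _; rewrite mulr_ge0 ?expR_ge0.
apply: le_trans (expR_ge1Dx _).
have : \sum_j p j * expR (s * l j) <=
    \sum_j p j * (1 + s * l j + (s * l j) ^+ 2 * expR `|s * l j|).
  by apply: ler_sum => j _; apply: ler_wpM2l => //; exact: expR_le_quadratic.
move/le_trans; apply.
have -> : \sum_j p j * (1 + s * l j + (s * l j) ^+ 2 * expR `|s * l j|) =
    (\sum_j p j) + s * m
    + s ^+ 2 * \sum_j p j * (l j ^+ 2 * expR (s * `|l j|)).
  rewrite /m !mulr_sumr -!big_split/=; apply: eq_bigr => j _.
  by rewrite normrM (ger0_norm s0); ring.
rewrite p1 -addrA !lerD2l; apply: ler_wpM2l => //; exact: sqr_ge0.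
Qed.

End Weighted.

(** The bound sees the weights and values only through [c], [B] and [nu], which is what makes the
    final estimate uniform in the number of levels. *)
Lemma geometric_mean_gap (R : realType) (J : finType) (p y : J -> R)
    (c B nu : R) (n : nat) :
  (forall j, 0 <= p j) -> \sum_j p j = 1 -> 0 < c ->
  (forall j, c <= y j) -> 0 < nu -> \sum_j p j * y j `^ nu <= B ->
  4 <= nu * n%:R ->
  (\sum_j p j * y j `^ (2 / n%:R)) ^+ n
    - (\sum_j p j * y j `^ n%:R^-1) ^+ n ^+ 2 <=
  expR (2 * (B / nu)) *
    (expR (4 * (8 / nu ^+ 2 * (B + c `^ (- nu))) / n%:R) - 1).
Proof.
move=> p0 p1 c0 cy nu0 yB n4.
have n0 : (0 < n)%N by rewrite lt0n; apply: contraTN n4 => /eqP ->;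
  rewrite mulr0 -ltNge.
have nR0 : 0 < n%:R :> R by rewrite ltr0n.
pose l j := ln (y j).
have y0 j : 0 < y j := lt_le_trans c0 (cy j).
have yE s j : y j `^ s = expR (s * l j) by rewrite /powR gt_eqF.
under eq_bigr do rewrite yE.
under [X in _ - X ^+ n ^+ 2]eq_bigr do rewrite yE.
have {}yB : \sum_j p j * expR (nu * l j) <= B.
  by under eq_bigr do rewrite -yE.
(* 8 / nu^2 is 2 / k^2 at k = nu / 2, from [sqr_le_expR_norm]. *)
set K := 8 / nu ^+ 2 * _; pose m := \sum_j p j * l j.
have mB : m <= B / nu.
  rewrite ler_pdivlMr// mulr_suml; apply: le_trans yB; apply: ler_sum => j _.
  rewrite -mulrA ler_wpM2l//; have := expR_ge1Dx (nu * l j).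
  by rewrite mulrC; lra.
(* For such n the exponent 2/n takes at most half of the available moment [nu]. *)
have s2 : 2 / n%:R <= nu / 2.
  by rewrite ler_pdivrMr// mulrAC ler_pdivlMr//; lra.
have QK : \sum_j p j * (l j ^+ 2 * expR (2 / n%:R * `|l j|)) <= K.
  have : \sum_j p j * (l j ^+ 2 * expR (2 / n%:R * `|l j|)) <=
     \sum_j p j * (8 / nu ^+ 2 * (expR (nu * l j) + c `^ (- nu))).
    apply: ler_sum => j _; apply: ler_wpM2l => //.
    apply: (@le_trans _ _ (8 / nu ^+ 2 * expR (nu * `|l j|))).
      (* one half of the exponent absorbs l_j^2 *)
      have -> : nu * `|l j| = nu / 2 * `|l j| + nu / 2 * `|l j| by field.
      rewrite expRD mulrA; apply: ler_pM.
      - exact: sqr_ge0.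
      - exact: expR_ge0.
      - apply: le_trans (sqr_le_expR_norm _ (_ : 0 < nu / 2)) _.
          by rewrite divr_gt0.
        by rewrite le_eqVlt; apply/orP; left; apply/eqP; field; lra.
      - by rewrite ler_expR ler_wpM2r.
    apply: ler_wpM2l; first by rewrite divr_ge0// sqr_ge0.
    (* If l_j >= 0 then e^(nu |l_j|) is y_j^nu, controlled in the mean by [B]; otherwise it is
       y_j^(-nu), at most c^(-nu). *)
    have [l0|l0] := leP 0 (l j).
      by rewrite ger0_norm// lerDl powR_ge0.
    rewrite ltr0_norm// -[leLHS]add0r lerD ?expR_ge0// /powR gt_eqF//.
    rewrite mulNr mulrN -mulNr -[in leRHS]mulNr ler_expR.
    have : ln c <= l j by rewrite ler_ln ?posrE.
    by nra.
  move/le_trans; apply.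
  rewrite (eq_bigr (fun j => 8 / nu ^+ 2 * (p j * expR (nu * l j)) +
    8 / nu ^+ 2 * c `^ (- nu) * p j)); last by move=> j _; ring.
  rewrite big_split/= -!mulr_sumr p1 mulr1 /K [leRHS]mulrDr lerD2r.
  by apply: ler_wpM2l => //; rewrite divr_ge0// sqr_ge0.
have s0 : 0 <= 2 / n%:R :> R by rewrite divr_ge0.
have up := sum_expR_pow_le p0 p1 n s0 QK.
have low := expR_mean_le l p0 p1 n0.
rewrite -/m in up low.
have {low}low : expR m ^+ 2 <= (\sum_j p j * expR (n%:R^-1 * l j)) ^+ n ^+ 2.
  by rewrite lerXn2r// nnegrE ?expR_ge0// (le_trans _ low) ?expR_ge0.
have upE : n%:R * (2 / n%:R * m + (2 / n%:R) ^+ 2 * K) = 2 * m + 4 * K / n%:R.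
  by field; rewrite gt_eqF.
rewrite upE expRD in up.
have E2 : expR m ^+ 2 = expR (2 * m) by rewrite expRM_natl.
apply: le_trans (lerB up low) _.
(* With e^(2m) factored out, m may be replaced by B / nu only once e^(4K/n) - 1 is nonnegative; 0 <=
   K is read off [QK]. *)
rewrite E2 -[X in _ - X]mulr1 -mulrBr ler_wpM2r//.
  rewrite subr_ge0 leNgt expR_lt1 -leNgt divr_ge0// ?ler0n// mulr_ge0//.
  apply: le_trans QK; apply: sumr_ge0 => j _.
  by rewrite mulr_ge0// mulr_ge0 ?expR_ge0 ?sqr_ge0.
by rewrite ler_expR ler_wpM2l.
Qed.

(** * Moments of a variable that is constant on each set of an almost sure finite partition *)

Section FinitePartition.
Context d (T : measurableType d) (R : realType) (P : probability T R).
Variables (J : finType) (A : J -> set T) (q : J -> R).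
Hypothesis mA : forall j, measurable (A j).
Hypothesis tA : trivIset [set: J] A.
Hypothesis PA : forall j, P (A j) = (q j)%:E.
Hypothesis q1 : \sum_j q j = 1.

(** Disjoint sets of total probability 1 miss only a null set. Covering everywhere is too much to
    ask: for attempts only the probabilities of the levels are prescribed, so other values may occur
    on a null set. *)
Lemma ae_partition_covers : {ae P, forall w, exists j, A j w}.
Proof.
have mU : measurable (\bigcup_j A j).
  by apply: fin_bigcup_measurable => //; exact: finite_finset.
have sumP : (\sum_j P (A j) = 1)%E.
  by under eq_bigr do rewrite PA; rewrite sumEFin q1.
have PU : (P (\bigcup_j A j) = 1)%E.
  rewrite measure_fin_bigcup//; last exact: finite_finset.
  have -> : [set: J] = [set` index_enum J].
    by apply/seteqP; split => // j _ /=; rewrite mem_index_enum.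
  by rewrite -fsbig_seq ?index_enum_uniq.
exists (~` (\bigcup_j A j)); split.
- exact: measurableC.
- by rewrite probability_setC// PU subee.
- by move=> w /= nA [j _ Ajw]; apply: nA; exists j.
Qed.

Lemma expectation_partition (H : T -> R) (K : J -> R) :
  measurable_fun setT H -> (forall j w, A j w -> H w = K j) ->
  ('E_P[H] = (\sum_j K j * q j)%:E)%E.
Proof.
move=> mH HK; rewrite unlock.
have iI j : P.-integrable setT (fun w => (K j)%:E * (\1_(A j) w)%:E)%E.
  apply: integrableZl => //; exact: integrable_indic.
rewrite (ae_eq_integral (fun w => \sum_j (K j)%:E * (\1_(A j) w)%:E)%E)//.
- rewrite integral_sum// -sumEFin; apply: eq_bigr => j _.
  rewrite integralZl//; last exact: integrable_indic.
  by rewrite integral_indic// setIT EFinM; congr (_ * _)%E; exact: PA.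
- exact/measurable_EFinP.
- apply: emeasurable_sum => j; exact: (measurable_int _ (iI j)).
- apply: filterS ae_partition_covers => w [j Ajw] _.
  rewrite (bigD1 j)//= big1 ?adde0.
    by rewrite (HK _ _ Ajw) indicE mem_set// mule1.
  move=> k kj; rewrite indicE memNset ?mule0// => Akw.
  by move/eqP: kj; apply; apply: tA => //; exists w.
Qed.

Lemma variance_partition (X : T -> R) (K : J -> R) :
  measurable_fun setT X -> (forall j w, A j w -> X w = K j) ->
  ('V_P[X] = (\sum_j K j ^+ 2 * q j - (\sum_j K j * q j) ^+ 2)%:E)%E.
Proof.
move=> mX XK; rewrite /variance unlock.
rewrite (expectation_partition mX XK)/=.
set m := \sum_j K j * q j.
rewrite (@expectation_partition _ (fun j => (K j - m) * (K j - m))).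
- congr EFin.
  have E x : \sum_j (K j - x) * (K j - x) * q j =
      \sum_j K j ^+ 2 * q j - 2 * x * (\sum_j K j * q j)
      + x ^+ 2 * \sum_j q j.
    by rewrite !mulr_sumr -sumrB -big_split/=; apply: eq_bigr => j _; ring.
  by rewrite E q1 -/m; ring.
- by apply: measurable_funM; apply: measurable_funB.
- by move=> j w /XK E; rewrite -E.
Qed.

End FinitePartition.

(** * Exact variance of the growth rate *)

Lemma powR_bigprod (R : realType) (n : nat) (F : 'I_n -> R) (s : R) :
  (forall i, 0 <= F i) -> (\prod_i F i) `^ s = \prod_i F i `^ s.
Proof.
move=> F0; suff [] : (\prod_i F i) `^ s = \prod_i F i `^ s /\ 0 <= \prod_i F i.
  by [].
elim/big_rec2: _ => [|i x y _ [<- y0]]; first by rewrite powR1.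
by rewrite powRM// mulr_ge0.
Qed.

Section Attempts.
Context d (T : measurableType d) (R : realType) (mu : {measure set T -> \bar R}).
Context (D : set T) (a : T -> R) (s : seq R).
Context d' (Omega : measurableType d') (P : probability Omega R).
Variables (n : nat) (Y : 'I_n -> {RV P >-> R}) (p : 'I_(size s) -> R).
Hypothesis s_sorted : sorted <%R s.
Hypothesis Yatt : are_attempts mu D a s Y.
Hypothesis pE : forall j : 'I_(size s), mu (cell D a s j) = (p j)%:E.
Hypothesis p1 : \sum_j p j = 1.

(** The event that the whole run of attempts follows [f]; on it the growth rate is constant, and
    these events form the partition for the variance. *)
Let outcome (f : {ffun 'I_n -> 'I_(size s)}) : set Omega :=
  \bigcap_(i in [set: 'I_n]) (Y i @^-1` [set s`_(f i)]).

Let measurable_outcome f : measurable (outcome f).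
Proof.
apply: fin_bigcap_measurable; first exact: finite_finset.
by move=> i _; rewrite -[_ @^-1` _]setTI; exact: measurable_funPT.
Qed.

Let trivIset_outcome : trivIset [set: {ffun 'I_n -> 'I_(size s)}] outcome.
Proof.
move=> f g _ _ [w [fw gw]]; apply/ffunP => i; apply/val_inj/eqP.
rewrite -(@nth_uniq _ 0 s) ?ltn_ord ?lt_sorted_uniq//.
by apply/eqP; rewrite -(fw i I) -(gw i I).
Qed.

Let P_outcome f : P (outcome f) = (\prod_i p (f i))%:E.
Proof.
have [ind law] := Yatt.
rewrite -prodEFin.
transitivity (P (\bigcap_(i in [set` [set: 'I_n]%SET])
    (Y i @^-1` [set s`_(f i)]))).
  by congr (P _); apply: eq_bigcapl; split => i //= _; rewrite inE.
rewrite (ind [set: 'I_n]%SET (fun i => [set s`_(f i)]))//.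
by apply: eq_big => [i|i _]; rewrite ?inE// law// pE.
Qed.

Let sum_outcome : \sum_(f : {ffun 'I_n -> 'I_(size s)}) \prod_i p (f i) = 1.
Proof.
by rewrite -(bigA_distr_bigA (fun=> p))/= p1 big1.
Qed.

(** On [outcome f] the growth rate is prod_i y_(f i)^(1/n), as the root of a product of nonnegative
    factors splits. Distributivity turns the sum over all [f] of products over attempts into a
    product of n equal sums over levels. *)
Lemma variance_growth_rate (u t : R) :
  (forall j : 'I_(size s), 0 <= s`_j * t / u - t + 1) ->
  let y (j : 'I_(size s)) := s`_j * t / u - t + 1 in
  ('V_P[growth_rate u t Y] =
   ((\sum_j p j * y j `^ (2 / n%:R)) ^+ n
    - (\sum_j p j * y j `^ n%:R^-1) ^+ n ^+ 2)%:E)%E.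
Proof.
move=> y0 y.
rewrite (@variance_partition _ _ _ _ _ outcome (fun f => \prod_i p (f i))
  _ _ _ _ _ (fun f => \prod_i y (f i) `^ n%:R^-1))//.
- congr (_%:E); congr (_ - _ ^+ 2).
    under eq_bigr do rewrite -prodrXl -big_split/=.
    rewrite -(bigA_distr_bigA (fun _ j => (y j `^ n%:R^-1) ^+ 2 * p j))/=.
    rewrite prodr_const card_ord; congr (_ ^+ _); apply: eq_bigr => j _.
    by rewrite mulrC -powR_mulrn ?powR_ge0// -powRrM [n%:R^-1 * _]mulrC.
  under eq_bigr do rewrite -big_split/=.
  rewrite -(bigA_distr_bigA (fun _ j => y j `^ n%:R^-1 * p j))/=.
  by rewrite prodr_const card_ord; congr (_ ^+ _); apply: eq_bigr => j _;
     rewrite mulrC.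
- apply: (measurableT_comp (measurable_powR _)).
  apply: measurable_prod => i _.
  apply: measurable_funD => //; apply: measurable_funB => //.
  by apply: measurable_funM => //; apply: measurable_funM.
- move=> f w fw; rewrite /growth_rate powR_bigprod; last first.
    by move=> i; rewrite (fw i I).
  by apply: eq_bigr => i _; rewrite (fw i I).
Qed.

End Attempts.

Lemma measurable_itv_completed_ls (R : realType) (F : cumulative R R)
    (I : interval R) :
  ((wlength F)^*)%mu.-cara.-measurable [set` I].
Proof.
apply: sub_caratheodory; exact: measurable_itv.
Qed.

(** * The cells of a level sequence and sums over them *)

Section Cells.
Context d (T : measurableType d) (R : realType) (mu : {measure set T -> \bar R}).
Context (D : set T) (a : T -> R) (s : seq R).
Hypothesis mD : measurable D.
Hypothesis ma : measurable_fun D a.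
Hypothesis s_sorted : sorted <%R s.

Lemma measurable_cell (j : nat) : measurable (cell D a s j).
Proof.
have -> : cell D a s j = (D `&` a @^-1` `[s`_j, +oo[) `&`
    (if (j.+1 < size s)%N then D `&` a @^-1` `]-oo, s`_j.+1[ else setT).
  apply/seteqP; split => [x [Dx sa ax]|x].
    split; first by split => //=; rewrite in_itv/= sa.
    by case: ifPn => // /ax ?; split => //=; rewrite in_itv.
  move=> [[Dx /=]]; rewrite in_itv/= andbT => sa h; split => // js.
  by move: h; rewrite js => -[_ /=]; rewrite in_itv.
apply: measurableI; first exact: ma.
by case: ifPn => // _; exact: ma.
Qed.

Lemma trivIset_cell : trivIset [set: 'I_(size s)] (fun j => cell D a s j).
Proof.
have lt_cells (i j : 'I_(size s)) x : (i < j)%N ->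
    cell D a s i x -> cell D a s j x -> False.
  (* As i < j, cell i is not the last, so its upper bound s_(i+1) is in force; it is at most s_j. *)
  move=> ij [_ _ /(_ (leq_ltn_trans ij (ltn_ord j))) axi] [_ jx _].
  have : s`_i.+1 <= s`_j.
    by rewrite (lt_sorted_leq_nth 0 s_sorted) ?inE// (leq_ltn_trans ij).
  by move=> /le_trans/(_ jx); rewrite leNgt axi.
move=> i j _ _ [x [ix jx]]; apply/val_inj.
by case: (ltngtP i j) => // /lt_cells; [move/(_ x ix jx)|move/(_ x jx ix)].
Qed.

Hypothesis s_gt0 : (0 < size s)%N.
Hypothesis s0_le : forall x, D x -> s`_0 <= a x.

(** A point x lies in the cell of the greatest index whose level is at most a(x); index 0 always
    qualifies. *)
Lemma bigcup_cell : \big[setU/set0]_(j < size s) cell D a s j = D.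
Proof.
rewrite -(bigcup_mkord _ (fun j => cell D a s j)).
apply/seteqP; split => [x [j _ []]//|x Dx].
have ex : exists j, (j < size s)%N && (s`_j <= a x).
  by exists 0%N; rewrite s_gt0 s0_le.
have ub j : (j < size s)%N && (s`_j <= a x) -> (j <= size s)%N.
  by case/andP => /ltnW.
case: (ex_maxnP ex ub) => j /andP[js sja] jmax.
exists j => //; split => // js1; rewrite ltNge; apply/negP => h.
by have := jmax j.+1; rewrite js1 h ltnn => /(_ isT).
Qed.

Lemma sum_integral_cell (g : T -> \bar R) :
  measurable_fun D g -> (forall x, D x -> 0 <= g x)%E ->
  (\sum_(j < size s) \int[mu]_(x in cell D a s j) g x =
   \int[mu]_(x in D) g x)%E.
Proof.
move=> mg g0; rewrite -[in RHS]bigcup_cell.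
rewrite ge0_integral_bigsetU ?bigcup_cell ?index_enum_uniq//.
- by move=> j; exact: measurable_cell.
- exact: sub_trivIset trivIset_cell.
Qed.

Hypothesis muD : mu D = 1%E.

Let p (j : 'I_(size s)) : R := fine (mu (cell D a s j)).

Lemma mu_cellE (j : 'I_(size s)) : mu (cell D a s j) = (p j)%:E.
Proof.
rewrite fineK// ge0_fin_numE//.
have : (mu (cell D a s j) <= mu D)%E.
  by apply: le_measure; rewrite ?inE//; [exact: measurable_cell|move=> x []].
by move=> /le_lt_trans; apply; rewrite muD ltry.
Qed.

Lemma sum_mu_cell : \sum_j p j = 1.
Proof.
apply: (@EFin_inj R); rewrite -sumEFin -muD -[mu D]mul1e -integral_cst//.
rewrite -sum_integral_cell//; apply: eq_bigr => j _.
by rewrite integral_cst ?mul1e ?mu_cellE//; exact: measurable_cell.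
Qed.

(** The sum is the integral of a step function lying below [g] on each cell, so a single [g] bounds
    the moments of all level sequences at once. *)
Lemma sum_cell_le (h : R -> R) (g : T -> \bar R) (B : R) :
  measurable_fun D g -> (forall x, D x -> 0 <= g x)%E ->
  (forall j, 0 <= h j) ->
  (forall (j : 'I_(size s)) x, cell D a s j x -> (h s`_j)%:E <= g x)%E ->
  (\int[mu]_(x in D) g x <= B%:E)%E ->
  \sum_j p j * h s`_j <= B.
Proof.
move=> mg g0 h0 hg gB; rewrite -lee_fin -sumEFin; apply: le_trans gB.
rewrite -sum_integral_cell//; apply: lee_sum => j _.
rewrite EFinM -mu_cellE muleC -integral_cst; last exact: measurable_cell.
apply: ge0_le_integral => //.
- exact: measurable_cell.
- by move=> x _; rewrite lee_fin.
- by apply: measurable_funS mg => // x [].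
- exact: hg.
Qed.

End Cells.

(** * An integrable majorant from effectiveness, and the double limit *)

Lemma moment_bound d (T : measurableType d) (R : realType)
    (mu : {measure set T -> \bar R}) (D : set T) (a : T -> R) (nu k : R) :
  measurable D -> measurable_fun D a -> mu D = 1%E -> 0 < nu -> 0 <= k ->
  (\int[mu]_(x in D `&` [set x | (1 < a x)%R]) (a x `^ nu)%:E < +oo)%E ->
  exists2 g : T -> \bar R,
    [/\ measurable_fun D g, (forall x, D x -> 0 <= g x)%E &
      (\int[mu]_(x in D) g x < +oo)%E] &
    (forall x (y : R), D x -> 0 <= y -> y <= a x * k + 1 -> ((y `^ nu)%:E <= g x)%E).
Proof.
move=> mD ma muD nu0 k0 fin.
pose E := D `&` [set x | 1 < a x].
have mE : measurable E.
  rewrite /E (_ : [set x | _] = a @^-1` `]1, +oo[); first exact: ma.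
  by apply/seteqP; split => x /=; rewrite in_itv/= andbT.
pose C := (1 + k) `^ nu.
have C0 : 0 <= C by exact: powR_ge0.
pose g1 := (fun x => (a x `^ nu)%:E : \bar R) \_ E.
have mg1 : measurable_fun D g1.
  apply/(measurable_restrict _ mE mD).
  rewrite setIA setIid; apply/measurable_EFinP.
  apply: (measurableT_comp (measurable_powR _)).
  by apply: measurable_funS ma => // x [].
have g10 x : (0 <= g1 x)%E.
  by rewrite /g1 /patch; case: ifPn => // _; rewrite lee_fin powR_ge0.
(* The majorant is (1 + k)^nu (1 + a^nu 1_{a > 1}): y <= (1 + k) a where a > 1, and y <= 1 + k
   elsewhere. Its integral is finite by effectiveness and [mu D = 1]. *)
exists (fun x => C%:E * (1 + g1 x))%E.
  split.
  - by apply: emeasurable_funM => //; apply: emeasurable_funD.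
  - by move=> x _; rewrite mule_ge0 ?adde_ge0 ?lee_fin.
  - rewrite ge0_integralZl//; last by move=> x _; rewrite adde_ge0.
      rewrite ge0_integralD// lte_mul_pinfty// ?lee_fin//.
      rewrite integral_cst// muD mul1e /g1 -integral_mkcondr.
      rewrite (_ : D `&` E = E); last by rewrite setIA setIid.
      by rewrite lte_add_pinfty// ltry.
    by apply: emeasurable_funD.
move=> x y Dx y0 yle.
have [a1|a1] := ltP 1 (a x).
  apply: (@le_trans _ _ (C%:E * g1 x)%E).
    rewrite /g1 patchE mem_set// -EFinM lee_fin -powRM//; last 2 first.
      lra.
      lra.
    have ya : y <= (1 + k) * a x by nra.
    by apply: ge0_ler_powR; rewrite ?nnegrE ?(ltW nu0)// (le_trans y0).
  by apply: lee_wpmul2l; rewrite ?lee_fin// leeDr.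
apply: (@le_trans _ _ (C%:E * 1)%E).
  have yk : y <= 1 + k by nra.
  rewrite mule1 lee_fin.
  by apply: ge0_ler_powR; rewrite ?nnegrE ?(ltW nu0)// (le_trans y0).
by apply: lee_wpmul2l; rewrite ?lee_fin// leeDl.
Qed.

(** The argument runs on an abstract measurable set of measure 1; the theorem is its instance for an
    interval under the completed Lebesgue-Stieltjes measure. *)
Lemma cvg_variance_growth_rate d (T : measurableType d) (R : realType)
    (mu : {measure set T -> \bar R}) (D : set T) (a : T -> R)
    (f : nat -> T -> R) (lev : nat -> seq R)
    (dO : nat -> nat -> measure_display)
    (Omega : forall N n : nat, measurableType (dO N n))
    (P : forall N n : nat, probability (Omega N n) R)
    (Y : forall N n : nat, 'I_n -> {RV (P N n) >-> R}) (u t : R) :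
  measurable D -> mu D = 1%E -> effective mu D a ->
  is_step_approximation D a f lev ->
  (forall N n : nat, are_attempts mu D a (lev N) (Y N n)) ->
  0 < u -> 0 <= t -> 0 < payoff_inf D a * t / u - t + 1 ->
  (fun q : nat * nat =>
     'V_(P q.1 q.2)[growth_rate u t (Y q.1 q.2)]) @ (\oo, \oo) --> 0%E.
Proof.
move=> mD muD [[ma lb _ _ _] [nu nu0 fin]] [lev_ok _ _ _] att u0 t0 c0.
have k0 : 0 <= t / u by rewrite divr_ge0// ltW.
have [g [mg g0 gfin] hg] := moment_bound mD ma muD nu0 k0 fin.
have intg : (\int[mu]_(x in D) g x <= (fine (\int[mu]_(x in D) g x))%:E)%E.
  by rewrite fineK// ge0_fin_numE// integral_ge0.
set B := fine _ in intg.
set c := payoff_inf D a * t / u - t + 1 in c0.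
(* [b] depends on n alone: [B] is the integral of the majorant [g], and [c] is the growth factor at
   the infimum of [a]. *)
pose b n : R := expR (2 * (B / nu)) *
  (expR (4 * (8 / nu ^+ 2 * (B + c `^ (- nu))) / n%:R) - 1).
have inf_le x : D x -> payoff_inf D a <= a x.
  by move=> Dx; apply: ge_inf => //; exists x.
have Vle N n : 4 <= nu * n%:R ->
    ('V_(P N n)[growth_rate u t (Y N n)] <= (b n)%:E)%E.
  move=> n4; have [s_gt0 s0E s_sorted] := lev_ok N.
  have s0_le x : D x -> (lev N)`_0 <= a x by rewrite s0E; exact: inf_le.
  have s0_lev (j : 'I_(size (lev N))) : payoff_inf D a <= (lev N)`_j.
    by rewrite -s0E (lt_sorted_leq_nth 0 s_sorted) ?inE.
  have yc (j : 'I_(size (lev N))) : c <= (lev N)`_j * t / u - t + 1.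
    by rewrite lerD2r lerD2r -!mulrA ler_wpM2r.
  have p1 := sum_mu_cell mD ma s_sorted s_gt0 s0_le muD.
  have pE := mu_cellE mD ma (s := lev N) muD.
  rewrite (variance_growth_rate s_sorted (att N n) pE p1); last first.
    by move=> j; rewrite (le_trans (ltW c0)).
  rewrite lee_fin; apply: geometric_mean_gap => //.
  apply: (sum_cell_le mD ma s_sorted s_gt0 s0_le muD
    (h := fun z => (z * t / u - t + 1) `^ nu) mg g0) => //.
    by move=> j; exact: powR_ge0.
  move=> j x [Dx jx _]; apply: hg => //; first by rewrite (le_trans (ltW c0)).
  have : (lev N)`_j * (t / u) <= a x * (t / u) by rewrite ler_wpM2r.
  by rewrite mulrA; lra.
have b_cvg : b n @[n --> \oo] --> 0.
  have invn : (n%:R^-1 : R) @[n --> \oo] --> 0.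
    (* The harmonic sequence is 1/(n+1), hence the shift. *)
    by rewrite -cvg_shiftS; exact: cvg_harmonic.
  have K_n (K : R) : expR (K / n%:R) @[n --> \oo] --> (1 : R).
    rewrite -[X in _ --> X]expR0; apply: continuous_cvg.
      exact: continuous_expR.
    by rewrite -(mulr0 K); apply: cvgM; [exact: cvg_cst|exact: invn].
  rewrite -(mulr0 (expR (2 * (B / nu)))); apply: cvgM; first exact: cvg_cst.
  by rewrite -(subrr 1); apply: cvgB; [exact: K_n|exact: cvg_cst].
apply: (@squeeze_cvge _ _ _ _ (cst 0%E) _ (fun q : nat * nat => (b q.2)%:E)).
(* The estimate holds for n >= 4 / nu and every N, so it holds eventually along the product
   filter. *)
- have n4 : \forall n \near \oo, 4 <= nu * n%:R.
    apply: filterS (nbhs_infty_ger (4 / nu)) => n.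
    by rewrite ler_pdivrMr// mulrC.
  have q4 : \forall q \near (\oo, \oo), 4 <= nu * (q : nat * nat).2%:R.
    exact: (cvg_snd n4).
  by apply: filterS q4 => q q4; rewrite variance_ge0 Vle.
- exact: cvg_cst.
- apply: cvg_EFin; first exact: nearW.
  exact: (cvg_comp _ _ cvg_snd b_cvg).
Qed.

Theorem lemma5p5 (R : realType) (I : interval R)
    (F : cumulativeBounded (0 : R) (1 : R)) (a : R -> R)
    (f : nat -> R -> R) (lev : nat -> seq R)
    (dO : nat -> nat -> measure_display)
    (Omega : forall N n : nat, measurableType (dO N n))
    (P : forall N n : nat, probability (Omega N n) R)
    (Y : forall N n : nat, 'I_n -> {RV (P N n) >-> R})
    (u t : R) :
  completed_lebesgue_stieltjes_measure F [set` I] = 1%E ->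
  effective (completed_lebesgue_stieltjes_measure F) [set` I] a ->
  is_step_approximation [set` I] a f lev ->
  (forall N n : nat, are_attempts (completed_lebesgue_stieltjes_measure F)
                       [set` I] a (lev N) (Y N n)) ->
  0 < u -> 0 <= t ->
  0 < payoff_inf [set` I] a * t / u - t + 1 ->
  (fun q : nat * nat =>
     'V_(P q.1 q.2)[growth_rate u t (Y q.1 q.2)]) @ (\oo, \oo) --> 0%E.
Proof.
move=> muD; apply: cvg_variance_growth_rate => //.
exact: measurable_itv_completed_ls.
Qed.
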